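(* Let $V$ be a finite-dimensional Euclidean space, $W$ a finite Coxeter group acting on $V$, $\mathcal{A}=\mathcal{A}(W)$ its Coxeter arrangement, and $\mathcal{B}$ a finite real hyperplane arrangement in $V$ stable under $W$ with $\mathcal{A}\cap\mathcal{B}=\emptyset$; put $\mathcal{C}=\mathcal{A}\cup\mathcal{B}$. Let $\varphi_{\mathcal{A}}:\mathbf{Ch}(\mathcal{C})\to\mathbf{Ch}(\mathcal{A})$ and $\varphi_{\mathcal{B}}:\mathbf{Ch}(\mathcal{C})\to\mathbf{Ch}(\mathcal{B})$ send a chamber of $\mathcal{C}$ to the unique chamber of $\mathcal{A}$ (resp. $\mathcal{B}$) containing it. Then: 1. For every $a\in\mathbf{Ch}(\mathcal{A})$, $$|\varphi_{\mathcal{A}}^{-1}(a)|=\frac{|\mathbf{Ch}(\mathcal{C})|}{|\mathbf{Ch}(\mathcal{A})|}=\frac{|\mathbf{Ch}(\mathcal{C})|}{|W|}=|\{W\text{-orbits of }\mathbf{Ch}(\mathcal{C})\}|=|\{W\text{-orbits of }\mathbf{Ch}(\mathcal{B})\}|.$$ 2. For every $b\in\mathbf{Ch}(\mathcal{B})$, $|\varphi_{\mathcal{B}}^{-1}(b)|=|W_b|$, where $W_b=\{w\in W\mid wb=b\}$.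
   Context: The Coxeter arrangement $\mathcal{A}(W)$ is the set of all reflecting hyperplanes of $W$. Hyperplanes of $\mathcal{B}$ may be affine. $\mathbf{Ch}(\mathcal{D})$ denotes the set of chambers (connected components of the complement of the union of the hyperplanes) of an arrangement $\mathcal{D}$, with the natural $W$-action. *)

(* Defs.v *)
From HB Require Import structures.
From mathcomp Require Import all_boot all_order all_algebra all_fingroup.
From mathcomp Require Import sesquilinear finmap.
From mathcomp Require Import all_classical all_reals all_analysis.

Set Implicit Arguments.
Unset Strict Implicit.
Unset Printing Implicit Defensive.

Import Order.TTheory GRing.Theory Num.Theory.
Import numFieldNormedType.Exports.

Local Open Scope classical_set_scope.
Local Open Scope ring_scope.

(* Number of elements of a finite set; the value on infinite sets is 0, so it
   is only meaningful together with [finite_set]. *)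
Definition ncard (T : choiceType) (S : set T) : nat := #|` fset_set S|%fset.

Definition finite_dimensional (R : nzRingType) (V : lmodType R) : Prop :=
  exists (n : nat) (e : 'I_n -> V),
    forall v : V, exists k : 'I_n -> R, v = \sum_(i < n) k i *: e i.

(* The norm of V, hence its topology, is the one given by the inner product. *)
Definition euclidean (R : realType) (V : normedModType R)
    (dot : {dot V for idfun}) : Prop :=
  finite_dimensional V /\ forall x : V, `|x| ^+ 2 = dot x x.

Section Arrangements.
Variables (R : realType) (V : normedModType R) (dot : {dot V for idfun}).
Implicit Types (a x : V) (c : R) (H : set V) (D : set (set V)).

(* {x | <a, x> = c}: affine in general, linear for c = 0. *)
Definition hyperplane a c : set V := [set x | dot a x = c].

Definition reflection a : V -> V :=
  fun x => x - (2 * dot a x / dot a a) *: a.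

Definition arrangement D : Prop :=
  finite_set D /\
  forall H, D H -> exists a c, a != 0 /\ H = hyperplane a c.

Definition complement D : set V := ~` \bigcup_(H in D) H.

Definition Ch D : set (set V) :=
  [set connected_component (complement D) x | x in complement D].

(* The chamber of D containing the set c, when there is a unique such chamber
   (see [chamber_of_unique]). *)
Definition chamber_of D (c : set V) : set V :=
  xget set0 [set d | Ch D d /\ c `<=` d].

Lemma chamber_of_unique (D C : set (set V)) (c : set V) :
  D `<=` C -> Ch C c ->
  [/\ Ch D (chamber_of D c), c `<=` chamber_of D c &
      forall d, Ch D d -> c `<=` d -> d = chamber_of D c].
Proof.
move=> DC [x Cx <-]; set c0 := connected_component _ x.
have CD : complement C `<=` complement D.
  by apply: subsetC; apply: bigcup_subset.
have c0x : c0 x by exact: connected_component_refl.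
have ex : exists d, [set d | Ch D d /\ c0 `<=` d] d.
  exists (connected_component (complement D) x); split.
    by exists x => //; exact: CD.
  apply: connected_component_max => //; last exact: component_connected.
  by apply: subset_trans CD; exact: connected_component_sub.
have [Chd cd] := xgetPex set0 ex.
split=> // d [y Dy <-] cy.
rewrite /chamber_of; move: (xget _ _) Chd cd => d' [z Dz <-] cz.
rewrite (same_connected_component (cy _ c0x)).
by rewrite (same_connected_component (cz _ c0x)).
Qed.

Variables (W : finGroupType) (act : W -> V -> V).

(* W is (identified by act with) a finite subgroup of the orthogonal group of
   V generated by reflections. *)
Record reflection_group : Prop := ReflectionGroup {
  rg_act1 : act 1%g = id ;
  rg_actM : forall g h : W, act (g * h)%g = act g \o act h ;
  rg_linear : forall g : W, linear (act g) ;
  rg_dot : forall (g : W) (x y : V), dot (act g x) (act g y) = dot x y ;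
  rg_faithful : injective act ;
  rg_generated :
    <<[set g : W | `[< exists2 a, a != 0 & act g = reflection a >]]%SET>>%g
      = [set: W]%SET }.

Definition coxeter_arrangement : set (set V) :=
  [set H | exists g a, [/\ a != 0, act g = reflection a & H = hyperplane a 0]].

Definition stable D : Prop := forall (g : W) H, D H -> D (act g @` H).

Definition orbit_of (c : set V) : set (set V) := [set act g @` c | g in setT].

Definition orbits D : set (set (set V)) := [set orbit_of c | c in Ch D].

Definition stabilizer (b : set V) : set W := [set g | act g @` b = b].

Definition fiber (C D : set (set V)) (d : set V) : set (set V) :=
  [set c | Ch C c /\ chamber_of D c = d].

End Arrangements.

(* Main.v *)
(**
Chambers of an arrangement are the classes of points joined by a segment that
misses the hyperplanes; hence they are convex, open, finite in number, and
permuted by every group preserving the arrangement.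

Freeness of W on Ch(A): relative to a point of a chamber, call a reflection
simple if it makes no positive root but its own negative.  Simple reflections
generate W, and the exchange condition shortens any word in them that
preserves positivity, down to the empty word.

Transitivity: if a reflecting hyperplane H meets a chamber b of B, then s_H
fixes a point of b, hence fixes b.  So if x and y lie in b and g minimises the
distance from g x to y subject to g x in b, no hyperplane of A separates g x
from y.  Therefore W_b is transitive on the chambers of C inside b, and W is
transitive on Ch(A) (take B empty).  Everything else is counting with these
two facts and the equivariance of the maps between sets of chambers.
*)

Require Import Defs.
From HB Require Import structures.
From mathcomp Require Import all_boot all_order all_algebra all_fingroup.
From mathcomp Require Import sesquilinear finmap.
From mathcomp Require Import all_classical all_reals all_analysis.
From mathcomp Require Import ring lra.

Import Order.TTheory GRing.Theory Num.Theory.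
Import numFieldNormedType.Exports.

Local Open Scope classical_set_scope.
Local Open Scope ring_scope.

Set Implicit Arguments.
Unset Strict Implicit.
Unset Printing Implicit Defensive.

(** * Reflections in an inner product space *)

Section Reflections.
Variables (R : realType) (V : normedModType R) (dot : {dot V for idfun}).
Implicit Types (a b x y z : V) (c k : R).

Lemma dotC x y : dot x y = dot y x.
Proof. by rewrite hermC/= expr0 mul1r. Qed.

Lemma dotDr x y z : dot x (y + z) = dot x y + dot x z.
Proof. exact: linearDr. Qed.

Lemma dotBr x y z : dot x (y - z) = dot x y - dot x z.
Proof. exact: linearBr. Qed.

Lemma dotNr x y : dot x (- y) = - dot x y.
Proof. exact: linearNr. Qed.

Lemma dotZr k x y : dot x (k *: y) = k * dot x y.
Proof. exact: linearZr_LR. Qed.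

Lemma dotDl x y z : dot (x + y) z = dot x z + dot y z.
Proof. exact: linearDl. Qed.

Lemma dotBl x y z : dot (x - y) z = dot x z - dot y z.
Proof. exact: linearBl. Qed.

Lemma dotNl x y : dot (- x) y = - dot x y.
Proof. exact: linearNl. Qed.

Lemma dotZl k x y : dot (k *: x) y = k * dot x y.
Proof. exact: linearZl_LR. Qed.

Lemma dot0l x : dot 0 x = 0.
Proof. exact: linear0l. Qed.

Definition dotE := (dotDr, dotDl, dotBr, dotBl, dotZr, dotZl, dotNr, dotNl).

Lemma dot_gt0 x : x != 0 -> 0 < dot x x.
Proof. exact: neq0_dnorm_gt0. Qed.

Lemma dot_le0 x : dot x x <= 0 -> x = 0.
Proof. by move=> h; apply/eqP/negPn/negP => /dot_gt0; rewrite ltNge h. Qed.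

Lemma reflection_scale k a : k != 0 -> reflection dot (k *: a) = reflection dot a.
Proof.
move=> k0; apply/funext => x; rewrite /reflection !dotE scalerA; congr (_ - _ *: _).
have [->|/dot_gt0/lt0r_neq0 a0] := eqVneq a 0; last by field; rewrite a0 k0.
by rewrite !dot0l !mulr0 !mul0r.
Qed.

Lemma reflection_id a x : dot a x = 0 -> reflection dot a x = x.
Proof. by move=> h; rewrite /reflection h mulr0 mul0r scale0r subr0. Qed.

Lemma reflection_fixed a x : a != 0 -> reflection dot a x = x -> dot a x = 0.
Proof.
move=> a0 h; have: dot a (reflection dot a x) = dot a x by rewrite h.
by rewrite /reflection !dotE divfK ?lt0r_neq0 ?dot_gt0// => h'; lra.
Qed.

Lemma reflection_unit a x : dot a a = 1 ->
  reflection dot a x = x - (2 * dot a x) *: a.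
Proof. by move=> a1; rewrite /reflection a1 divr1. Qed.

(** Equality case of Cauchy-Schwarz: the squared norm of [a - b] is [2 - 2 * dot a b]. *)
Lemma unit_eq a b : dot a a = 1 -> dot b b = 1 -> 1 <= dot a b -> a = b.
Proof.
move=> a1 b1 ab; apply/subr0_eq/dot_le0.
by rewrite !dotE a1 b1 (dotC b a); lra.
Qed.

(** Evaluate both reflections at [a], which the first one negates: this gives [a = dot b a *: b],
    hence [dot a b ^+ 2 = 1]. *)
Lemma reflection_inj_unit a b : dot a a = 1 -> dot b b = 1 ->
  reflection dot a = reflection dot b -> a = b \/ a = - b.
Proof.
move=> a1 b1 /(congr1 (fun f => f a)); rewrite !reflection_unit// a1 => ab.
have ab2 : dot a b ^+ 2 = 1.
  have := congr1 (dot a) ab; rewrite !dotE a1 (dotC b a) => h.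
  by rewrite expr2; lra.
have /orP[/eqP h|/eqP h]: (dot a b == 1) || (dot a b == -1).
- by rewrite -sqrf_eq1 ab2.
- by left; apply: unit_eq => //; rewrite h.
- by right; apply: unit_eq; rewrite ?dotE ?b1 ?h ?opprK.
Qed.

(** The mirror strictly separates [x] from [y]. Folding [x] across it changes the squared distance
    by [2 * (k * dot a y)], and [k] has the sign of [dot a x]. *)
Lemma reflection_closer a x y : dot a x * dot a y < 0 ->
  dot (reflection dot a x - y) (reflection dot a x - y) < dot (x - y) (x - y).
Proof.
move=> xy; have a0 : 0 < dot a a.
  apply: dot_gt0; apply/eqP => a0; move: xy.
  by rewrite a0 !dot0l mul0r ltxx.
rewrite /reflection; set k := _ / _.
have kE : k * dot a a = 2 * dot a x by rewrite divfK// lt0r_neq0.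
rewrite -subr_lt0 !dotE (dotC x a) (dotC y a) kE.
rewrite [ltLHS](_ : _ = 2 * (k * dot a y)); last by ring.
rewrite pmulr_rlt0// /k (mulrAC _ (dot a a)^-1) pmulr_llt0 ?invr_gt0//.
by rewrite -mulrA pmulr_rlt0.
Qed.

End Reflections.

(** * Positive roots and simple reflections *)

Section ReflectionGroup.
Variables (R : realType) (V : normedModType R) (dot : {dot V for idfun}).
Variables (W : finGroupType) (act : W -> V -> V).
Hypothesis rg : reflection_group dot act.
Implicit Types (g h s w : W) (x y : V).

Lemma rg_act1E x : act 1%g x = x.
Proof. by rewrite (rg_act1 rg). Qed.

Lemma rg_actME g h x : act (g * h)%g x = act g (act h x).
Proof. by rewrite (rg_actM rg). Qed.

Lemma rg_actK g x : act g^-1%g (act g x) = x.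
Proof. by rewrite -rg_actME mulVg rg_act1E. Qed.

Lemma rg_actVK g x : act g (act g^-1%g x) = x.
Proof. by rewrite -rg_actME mulgV rg_act1E. Qed.

Lemma rg_actD g x y : act g (x + y) = act g x + act g y.
Proof. by have := rg_linear rg g 1 x y; rewrite !scale1r. Qed.

Lemma rg_act0 g : act g 0 = 0.
Proof. by apply: (addrI (act g 0)); rewrite -rg_actD !addr0. Qed.

Lemma rg_actZ g (k : R) x : act g (k *: x) = k *: act g x.
Proof. by have := rg_linear rg g k x 0; rewrite rg_act0 !addr0. Qed.

Lemma rg_actN g x : act g (- x) = - act g x.
Proof. by rewrite -scaleN1r rg_actZ scaleN1r. Qed.

Lemma rg_actB g x y : act g (x - y) = act g x - act g y.
Proof. by rewrite rg_actD rg_actN. Qed.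

Lemma rg_act_neq0 g x : x != 0 -> act g x != 0.
Proof. by apply: contraNneq => h; rewrite -(rg_actK g x) h rg_act0. Qed.

Lemma rg_dotl g x y : dot (act g x) y = dot x (act g^-1%g y).
Proof. by rewrite -{1}(rg_actVK g y) (rg_dot rg). Qed.

Lemma act_reflection g h a : act h = reflection dot a ->
  act (g * h * g^-1)%g = reflection dot (act g a).
Proof.
move=> ha; apply/funext => x.
rewrite !rg_actME ha /reflection rg_actB rg_actZ rg_actVK (rg_dot rg).
by rewrite rg_dotl.
Qed.

Local Notation A := (coxeter_arrangement dot act).

Lemma coxeter_stable : stable act A.
Proof.
move=> g _ [h [a [a0 ha ->]]].
exists (g * h * g^-1)%g, (act g a); split; first exact: rg_act_neq0.
  exact: act_reflection.
apply/seteqP; split=> [_ [x hx <-]|x hx].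
  by rewrite /hyperplane/= (rg_dot rg).
by exists (act g^-1%g x); rewrite ?rg_actVK//= /hyperplane/= -rg_dotl.
Qed.

(** Each mirror is the fixed set of its reflection, so [A] embeds in a family indexed by the finite
    group [W]. *)
Lemma coxeter_arrangementP : arrangement dot A.
Proof.
split; last by move=> _ [g [a [a0 _ ->]]]; exists a, 0.
apply: (@sub_finite_set _ _ [set [set x | act g x = x] | g in [set: W]]).
  move=> _ [g [a [a0 ga ->]]]; exists g => //.
  apply/seteqP; split=> x; rewrite /hyperplane/= ga.
    exact: reflection_fixed.
  exact: reflection_id.
by apply: finite_image; exact: finite_finset.
Qed.

Section PositiveRoots.
Variable x0 : V.
Hypothesis x0A : complement A x0.

Definition is_reflection g := `[< exists2 a, a != 0 & act g = reflection dot a >].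

(** Unit length and the side of [x0] single out one vector on the line orthogonal to the mirror, so
    the choice made by [xget] below is canonical. *)
Definition is_positive_root g a :=
  [/\ dot a a = 1, 0 < dot a x0 & act g = reflection dot a].

Definition positive_root g : V := xget 0 (is_positive_root g).

Lemma regular_dot_neq0 g a : a != 0 -> act g = reflection dot a -> dot a x0 != 0.
Proof.
move=> a0 ga; apply/negP => /eqP h; apply: x0A.
by exists (hyperplane dot a 0) => //; exists g, a.
Qed.

Lemma positive_rootP g : is_reflection g -> is_positive_root g (positive_root g).
Proof.
move=> /asboolP[a a0 ga]; apply: xgetPex.
have ax := regular_dot_neq0 a0 ga.
have aa := dot_gt0 dot a0.
(* Dividing by the length normalises [a]; the sign moves [x0] to the positive side. *)
pose k := Num.sg (dot a x0) / Num.sqrt (dot a a).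
have sq0 : 0 < Num.sqrt (dot a a) by rewrite sqrtr_gt0.
have k0 : k != 0 by rewrite mulf_neq0 ?sgr_eq0// invr_eq0 lt0r_neq0.
exists (k *: a); split; last by rewrite reflection_scale.
  rewrite !dotE mulrA -expr2 /k exprMn exprVn sqr_sqrtr ?ltW//.
  by rewrite sqr_sg ax mul1r mulVf ?gt_eqF.
by rewrite dotE /k mulrAC -normrEsg divr_gt0 ?normr_gt0.
Qed.

Lemma positive_root_unique g a : is_positive_root g a -> positive_root g = a.
Proof.
move=> [a1 ax ga]; have g_refl : is_reflection g.
  apply/asboolP; exists a => //; apply/eqP => a0.
  by move: ax; rewrite a0 dot0l ltxx.
have [b1 bx gb] := positive_rootP g_refl.
have [-> //|ba] : positive_root g = a \/ positive_root g = - a.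
  by apply: reflection_inj_unit b1 a1 _; rewrite -gb.
by move: bx; rewrite ba dotNl oppr_gt0 ltNge ltW.
Qed.

Lemma is_reflectionJ g w : is_reflection g -> is_reflection (w * g * w^-1)%g.
Proof.
move=> /asboolP[a a0 ga]; apply/asboolP; exists (act w a); first exact: rg_act_neq0.
exact: act_reflection.
Qed.

Lemma reflection_sqr g : is_reflection g -> (g * g = 1)%g.
Proof.
move=> /positive_rootP[a1 _ ga]; apply: (rg_faithful rg); apply/funext => x.
rewrite rg_actME ga rg_act1E !reflection_unit// !dotE a1 mulr1.
rewrite -addrA -opprD -scalerDl [X in X *: _](_ : _ = 0) ?scale0r ?subr0//; ring.
Qed.

Lemma positive_root_inj g h : is_reflection g -> is_reflection h ->
  positive_root g = positive_root h -> g = h.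
Proof.
move=> /positive_rootP[_ _ gE] /positive_rootP[_ _ hE] gh.
by apply: (rg_faithful rg); rewrite gE hE gh.
Qed.

(** The conjugate reflects along [act w (positive_root g)], again a unit vector and never orthogonal
    to the regular point [x0], so only its sign is in doubt. *)
Lemma positive_rootJ w g : is_reflection g ->
  if 0 < dot (act w (positive_root g)) x0
  then positive_root (w * g * w^-1)%g = act w (positive_root g)
  else positive_root (w * g * w^-1)%g = - act w (positive_root g).
Proof.
move=> gr; have [a1 ax ga] := positive_rootP gr.
have wga := act_reflection w ga.
have w1 : dot (act w (positive_root g)) (act w (positive_root g)) = 1.
  by rewrite (rg_dot rg).
case: ifPn => [h|]; first exact: positive_root_unique.
have a0 : positive_root g != 0.
  by apply/eqP => h; move: a1; rewrite h dot0l => /eqP; rewrite eq_sym oner_eq0.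
rewrite -leNgt le_eqVlt (negPf (regular_dot_neq0 (rg_act_neq0 w a0) wga))/= => h.
apply: positive_root_unique; split.
- by rewrite !dotE opprK.
- by rewrite dotNl oppr_gt0.
- by rewrite wga -scaleN1r reflection_scale// oppr_eq0 oner_eq0.
Qed.

(** Simplicity is encoded by its effect on positive roots, the property that the exchange argument
    consumes, rather than by indecomposability or a basis. *)
Definition simple s : bool := is_reflection s &&
  [forall h, (is_reflection h && (h != s)) ==>
    (0 < dot (act s (positive_root h)) x0)].

Lemma simple_reflection s : simple s -> is_reflection s.
Proof. by case/andP. Qed.

Lemma simple_gt0 s h : simple s -> is_reflection h -> h != s ->
  0 < dot (act s (positive_root h)) x0.
Proof. by move=> /andP[_ /forallP/(_ h)/implyP H] h1 h2; apply: H; rewrite h1. Qed.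

(* The ratio [r] is attained where the ray from [x0] in the direction of
   [- positive_root h] first meets a hyperplane.  Among the roots tied for it,
   the one closest to being orthogonal to [x0] is not a sum of two others. *)
Lemma simple_root_acute h : is_reflection h ->
  exists2 s, simple s & 0 < dot (positive_root s) (positive_root h).
Proof.
move=> hr; have [b1 bx hb] := positive_rootP hr; set b := positive_root h in b1 bx hb *.
pose rt := positive_root.
pose Q g := is_reflection g && (0 < dot (rt g) b).
have Qh : Q h by rewrite /Q hr /rt -/b b1 ltr01.
case: (arg_minP (fun g => dot (rt g) x0 / dot (rt g) b) Qh) => g1 /andP[g1r g1b] min1.
set r := dot (rt g1) x0 / dot (rt g1) b in min1.
have r0 : 0 < r by have [_ ? _] := positive_rootP g1r; rewrite divr_gt0.
(* Minimality of [r] becomes a linear inequality on all positive roots: where [dot (rt g) b <= 0] it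
   is trivial. *)
have rle g : is_reflection g -> r * dot (rt g) b <= dot (rt g) x0.
  move=> gr; have [_ gx _] := positive_rootP gr.
  have [gb|gb] := ltP 0 (dot (rt g) b).
    by rewrite -ler_pdivlMr// min1// /Q gr.
  by apply: le_trans (ltW gx); rewrite pmulr_rle0.
pose Q' g := is_reflection g && (dot (rt g) x0 == r * dot (rt g) b).
have Q'1 : Q' g1 by rewrite /Q' g1r /r divfK ?eqxx// lt0r_neq0.
case: (arg_minP (fun g => dot (rt g) x0) Q'1) => s /andP[sr /eqP sE] min2.
have [s1 sx ss] := positive_rootP sr.
exists s; last by rewrite -(pmulr_rgt0 _ r0) -sE.
rewrite /simple sr; apply/forallP => h'; apply/implyP => /andP[h'r h's].
(* If [s] made [rt h'] negative, then [rt g = - act s (rt h')] would be positive, and [rt h' + rt g]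
   would be a multiple of [rt s]. *)
have := positive_rootJ s h'r; case: ifPn => // _; set g := (s * h' * _)%g => gE.
have gr : is_reflection g by exact: is_reflectionJ.
have {}gE y : dot (rt g) y = 2 * dot (rt s) (rt h') * dot (rt s) y - dot (rt h') y.
  by rewrite /rt gE ss reflection_unit// !dotE; ring.
have rg_ := rle _ gr; have rh_ := rle _ h'r.
have := gE x0; have := gE b => gb gx.
(* The inequalities [rle] for [h'] and [g] add up to an equality, since [sE] holds for multiples of
   [rt s]; so both are equalities and both roots are tied with [rt s]. *)
have eq_h : dot (rt h') x0 = r * dot (rt h') b.
  apply/le_anti; rewrite rh_ andbT.
  by move: rg_; rewrite gb gx sE; lra.
have eq_g : dot (rt g) x0 = r * dot (rt g) b by rewrite gx gb eq_h sE; ring.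
have m1 : dot (rt s) x0 <= dot (rt h') x0 by apply: min2; rewrite /Q' h'r eq_h eqxx.
have m2 : dot (rt s) x0 <= dot (rt g) x0 by apply: min2; rewrite /Q' gr eq_g eqxx.
have [h1 _ _] := positive_rootP h'r.
(* By [m1] and [m2] the two values at [x0] add up to at least twice that of [rt s], so
   [dot (rt s) (rt h') >= 1] and the unit vectors coincide. *)
case/eqP: h's; apply: positive_root_inj => //; apply/esym/(unit_eq s1 h1).
rewrite -(ler_pM2r sx) mul1r; move: m1 m2; rewrite gx /rt; lra.
Qed.

(** Descent on [dot (positive_root h) x0] over the conjugates [h] of a reflection under the group
    [M] generated by simple ones. If a minimal [h] were not simple, conjugating it by a simple [s]
    with root at an acute angle would lower the value. *)
Lemma simple_generate : <<[set s | simple s]%SET>>%g = [set: W]%SET.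
Proof.
apply/eqP; rewrite finset.eqEsubset finset.subsetT/= -(rg_generated rg) gen_subG.
apply/fintype.subsetP => g; rewrite inE => gr.
pose M := <<[set s | simple s]%SET>>%G; rewrite -[_ \in _]/(g \in M).
have memC h : h \in (g ^: M)%g -> is_reflection h.
  by case/imsetP => w _ ->; rewrite conjgE -{2}(invgK w) mulgA; exact: is_reflectionJ.
case: (arg_minP (fun h => dot (positive_root h) x0) (class_refl M g)) => h hg hmin.
have hM : h \in M -> g \in M.
  by case/imsetP: hg => w wM -> gw; rewrite -(groupJr _ wM).
have hr := memC _ hg.
have [sh|sh] := boolP (simple h); first by apply: hM; rewrite mem_gen// inE.
have [s ss sh0] := simple_root_acute hr.
have hs : h != s by apply: contraNneq sh => ->.
have sr := simple_reflection ss.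
have sM : s \in M by rewrite mem_gen// inE.
have := positive_rootJ s hr; rewrite simple_gt0// => sE.
have : (s * h * s^-1)%g \in (g ^: M)%g.
  case/imsetP: hg => w wM ->; apply/imsetP; exists (w * s^-1)%g.
    by rewrite groupM ?groupV.
  by rewrite !conjgE invMg invgK !mulgA.
move=> /hmin; rewrite sE; have [s1 sx ->] := positive_rootP sr.
rewrite reflection_unit// !dotE => H.
have := mulr_gt0 sh0 sx; move: H; lra.
Qed.

(** Apply the letters from the right. The first one that turns the image of the root negative is
    simple, so that image is its own root: the letter equals the conjugate of [h] by the suffix
    after it, and moving [h] leftwards cancels it. *)
Lemma exchange (ss : seq W) h : all simple ss -> is_reflection h ->
  ~~ (0 < dot (act (\prod_(s <- ss) s)%g (positive_root h)) x0) ->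
  exists2 tt, all simple tt /\ (size tt < size ss)%N &
    (\prod_(s <- ss) s * h = \prod_(s <- tt) s)%g.
Proof.
move=> + hr; elim: ss => [_|s ss IH] /=.
  by rewrite big_nil rg_act1E; have [_ -> _] := positive_rootP hr.
move=> /andP[s_s ss_s]; rewrite big_cons rg_actME; set q := (\prod_(s <- ss) s)%g.
have := positive_rootJ q hr; case: ifPn => [_ <- neg|neg _ _].
  have eq_s : (q * h * q^-1)%g = s.
    apply/eqP/negPn/negP => ne; move: neg; rewrite simple_gt0//.
    exact: is_reflectionJ.
  exists ss => //; rewrite -/q -mulgA -(mulgKV q (q * h)%g) eq_s mulgA.
  by rewrite reflection_sqr ?mul1g// simple_reflection.
have [tt [tt_s tt_lt] ttE] := IH ss_s neg.
exists (s :: tt); first by rewrite /= s_s tt_s.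
by rewrite big_cons -ttE mulgA.
Qed.

(** Induction on the length of a word in simple reflections for [w]: a nonempty word can always be
    shortened. *)
Lemma positive_preserving_eq1 w :
  (forall h, is_reflection h -> 0 < dot (act w (positive_root h)) x0) -> w = 1%g.
Proof.
move=> wpos; have : w \in <<[set s | simple s]%SET>>%g by rewrite simple_generate inE.
move=> /gen_prodgP[n [c cs wE]].
have {n c cs wE} [ss ss_s wE] : exists2 ss, all simple ss & w = (\prod_(s <- ss) s)%g.
  exists [seq c i | i <- index_enum 'I_n].
    by apply/allP => _ /mapP[i _ ->]; have := cs i; rewrite inE.
  by rewrite big_map.
have [n] := ubnP (size ss); elim: n => // n IH in ss ss_s wE *.
case/lastP: ss ss_s wE => [_ ->|ss s]; first by rewrite big_nil.
rewrite all_rcons size_rcons => /andP[s_s ss_s]; rewrite -cats1 big_cat big_seq1/= => wE.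
have sr := simple_reflection s_s.
(* [w] keeps the root of its last letter [s] positive while [s] negates it, so the prefix [ss] makes
   it negative. *)
have [|tt [tt_s tt_lt] ttE] := exchange ss_s sr.
  have := wpos _ sr; rewrite wE rg_actME.
  have [s1 sx ->] := positive_rootP sr.
  rewrite reflection_unit// s1 mulr1 [X in act _ X](_ : _ = - positive_root s).
    by rewrite rg_actN dotNl oppr_gt0 -leNgt => /ltW.
  by rewrite scaler_nat mulr2n opprD addrA subrr add0r.
by move=> lt_n; apply: (IH tt) => //; [rewrite wE|exact: leq_trans tt_lt (ltnW lt_n)].
Qed.

End PositiveRoots.
End ReflectionGroup.

(** * Chambers as classes of points joined by segments *)

Section Chambers.
Variables (R : realType) (V : normedModType R) (dot : {dot V for idfun}).
Hypothesis normE : forall x : V, `|x| ^+ 2 = dot x x.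
Implicit Types (x y z : V) (D : set (set V)).

(** Polarisation expresses [dot a] through the norm; this ties the inner product to the topology. *)
Lemma dot_continuous a : continuous (dot a).
Proof.
have -> : Dot.sort dot a = fun x => 2^-1 * (`|a + x| ^+ 2 - `|a| ^+ 2 - `|x| ^+ 2).
  by apply/funext => x; rewrite !normE !dotE (dotC dot x a); field.
move=> x; apply: cvgM; first exact: cvg_cst.
apply: cvgB; last by rewrite expr2; apply: cvgM; apply: cvg_norm.
apply: cvgB; last exact: cvg_cst.
by rewrite expr2; apply: cvgM; apply: cvg_norm; apply: cvgD => //; exact: cvg_cst.
Qed.

(** Intermediate value theorem for an affine function with end values [u] and [v], with the explicit
    root [u / (u - v)] when they differ. *)
Lemma segment_root (u v : R) :
  (exists t, 0 <= t <= 1 /\ u + t * (v - u) = 0) <-> u * v <= 0.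
Proof.
split=> [[t [/andP[t0 t1] tE]]|uv].
  move: t0; rewrite le_eqVlt => /predU1P[t0|t0].
    by move: tE; rewrite -t0 mul0r addr0 => ->; rewrite mul0r.
  rewrite -(pmulr_rle0 _ t0) (_ : t * _ = - ((1 - t) * u ^+ 2)); last first.
    by apply/eqP; rewrite -subr_eq0 opprK (_ : _ + _ = u * (u + t * (v - u)));
      [rewrite tE mulr0|ring].
  by rewrite oppr_le0 mulr_ge0 ?sqr_ge0 ?subr_ge0.
have [uv0|uv0] := eqVneq u v.
  exists 0; rewrite lexx ler01 mul0r addr0; split=> //.
  by apply/eqP; rewrite -sqrf_eq0 eq_le sqr_ge0 andbT expr2 {2}uv0.
exists (u / (u - v)); split; last by field; rewrite subr_eq0.
move: uv0; rewrite neq_lt => /orP[lt_uv|lt_vu].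
  rewrite -mulrNN -invrN opprB divr_ge0/= ?ler_pdivrMr ?subr_gt0//; nra.
rewrite divr_ge0/= ?ler_pdivrMr ?subr_gt0//; nra.
Qed.

(** For arrangements this agrees with lying in one connected component, and it is easier to
    transport: linear maps send segments to segments. *)
Definition joined D x y :=
  forall t : R, 0 <= t <= 1 -> complement D (x + t *: (y - x)).

Lemma joined_connected D x y :
  joined D x y -> connected_component (complement D) x y.
Proof.
move=> xy; pose f (t : R) := x + t *: (y - x).
have fc : connected (f @` `[0, 1]).
  apply: connected_continuous_connected; first exact: segment_connected.
  apply: continuous_subspaceT => t; apply: cvgD; first exact: cvg_cst.
  by apply: cvgZr_tmp.
apply: (connected_component_max _ _ fc).
- by exists 0; rewrite /f ?scale0r ?addr0//= in_itv/= lexx ler01.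
- by move=> _ [t /= t01 <-]; apply: xy; move: t01; rewrite in_itv.
- by exists 1; rewrite /f ?scale1r ?subrKC//= in_itv/= lexx ler01.
Qed.

(** [dot a] maps the component onto an interval. If the segment met a hyperplane of level [c], then
    [c] would lie between the end values, and a point of the component would lie on that
    hyperplane. *)
Lemma connected_joined D x y : arrangement dot D ->
  connected_component (complement D) x y -> joined D x y.
Proof.
move=> [_ Dhyp] xy t /andP[t0 t1] [H DH HP].
have [a [c [a0 HE]]] := Dhyp _ DH; move: HP; rewrite HE /hyperplane/= => ptc.
have xx : connected_component (complement D) x x.
  apply: connected_component_refl; apply: contrapT => h.
  by move: xy; rewrite connected_component_out.
set K := connected_component _ x in xy xx.
have Kint : is_interval (dot a @` K).
  apply/connected_intervalP; apply: connected_continuous_connected.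
    exact: component_connected.
  by apply: continuous_subspaceT; exact: dot_continuous.
suff [z Kz zc] : (dot a @` K) c.
  by apply: (connected_component_sub Kz); exists H => //; rewrite HE.
have [le_xy|le_yx] := leP (dot a x) (dot a y).
- apply: (Kint (dot a x) (dot a y)); [by exists x|by exists y|].
  by rewrite -ptc !dotE; apply/andP; split; nra.
- apply: (Kint (dot a y) (dot a x)); [by exists y|by exists x|].
  by rewrite -ptc !dotE; apply/andP; split; nra.
Qed.

Lemma joined_same_side D a c x y : D (hyperplane dot a c) -> joined D x y ->
  (dot a x < c) = (dot a y < c).
Proof.
move=> DH xy; have : ~ (dot a x - c) * (dot a y - c) <= 0.
  move=> /segment_root[t [t01 tE]]; apply: (xy t t01); exists (hyperplane dot a c) => //.
  by rewrite /hyperplane/= !dotE; lra.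
by case: ltP => hx; case: ltP => hy // []; nra.
Qed.

Lemma complementU D D' : complement (D `|` D') = complement D `&` complement D'.
Proof. by rewrite /complement bigcup_setU setCU. Qed.

Lemma joinedU D D' x y : joined D x y -> joined D' x y -> joined (D `|` D') x y.
Proof. by move=> xy xy' t t01; rewrite complementU; split; [exact: xy|exact: xy']. Qed.

Lemma hyperplane_closed a c : closed (hyperplane dot a c).
Proof.
apply: (@closed_comp _ _ (dot a) [set c]); last exact: closed_eq.
by move=> x _; exact: dot_continuous.
Qed.

Lemma complement_open D : arrangement dot D -> open (complement D).
Proof.
move=> [Dfin Dhyp]; rewrite openC; apply: closed_bigcup => // H DH.
by have [a [c [_ ->]]] := Dhyp _ DH; exact: hyperplane_closed.
Qed.

(** A ball about [y] inside the open complement contains the segments from [y] to its points, so all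
    of it lies in the component of [y]. *)
Lemma chamber_open D x : arrangement dot D ->
  open (connected_component (complement D) x).
Proof.
move=> DA; rewrite openE => y xy.
have : nbhs y (complement D).
  apply: open_nbhs_nbhs; split; first exact: complement_open.
  exact: connected_component_sub xy.
rewrite /interior => /nbhs_ballP[e e0 De]; apply/nbhs_ballP; exists e => // z yz.
rewrite (same_connected_component xy); apply: joined_connected => t /andP[t0 t1].
apply: De; move: yz; rewrite -!ball_normE/= opprD addrA subrr add0r normrN normrZ.
by rewrite distrC; apply: le_lt_trans; rewrite ger0_norm// ler_piMl.
Qed.

(** Treat the hyperplanes one at a time: leave [H] by a short step along its normal, then remove the
    closed set [H] from [O] before going on. *)
Lemma avoid_hyperplanes D (O : set V) x : arrangement dot D -> open O -> O x ->
  exists2 y, O y & complement D y.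
Proof.
move=> [/finite_seqP[s DE] Dhyp].
have {Dhyp} : forall H, H \in s -> exists a c, a != 0 /\ H = hyperplane dot a c.
  by move=> H Hs; apply: Dhyp; rewrite DE.
rewrite {}DE; elim: s => [|H s IH] in O x *.
  by move=> _ _ Ox; exists x => // -[].
move=> Hhyp Oo Ox.
have [a [c [a0 HE]]] := Hhyp H (mem_head _ _).
have [y Oy Hy] : exists2 y, O y & ~ H y.
  have [Hx|Hx] := pselect (H x); last by exists x.
  have /nbhs_ballP[e /= e0 Oe] : nbhs x O by exact: open_nbhs_nbhs.
  have na : 0 < `|a| by rewrite normr_gt0.
  exists (x + (e / 2 / `|a|) *: a).
    apply: Oe; rewrite -ball_normE/= opprD addrA subrr add0r normrN normrZ.
    rewrite ger0_norm; last by rewrite divr_ge0// ltW// divr_gt0.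
    by rewrite divfK ?gt_eqF// ltr_pdivrMr// ltr_pMr// ltr1n.
  move: Hx; rewrite HE /hyperplane/= !dotE => -> /eqP.
  rewrite -subr_eq0 addrAC subrr add0r; apply/negP.
  by rewrite mulf_neq0// gt_eqF// ?divr_gt0// dot_gt0.
have [||//|z [Oz nHz] Dz] := IH (O `&` ~` H) y.
- by move=> H' H's; apply: Hhyp; rewrite inE H's orbT.
- by apply: openI => //; rewrite HE openC; exact: hyperplane_closed.
exists z => // -[H' /=]; rewrite inE => /orP[/eqP -> //|H's H'z].
by apply: Dz; exists H'.
Qed.

(** A chamber is the set of points of the complement with a given sign vector, and there are
    finitely many such vectors. *)
Lemma Ch_finite D : arrangement dot D -> finite_set (Ch D).
Proof.
move=> DA; have [/finite_seqP[s DE] Dhyp] := DA.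
have {Dhyp} : forall H, exists ac, D H -> H = hyperplane dot ac.1 ac.2.
  move=> H; have [/Dhyp[a [c [_ ->]]]|nH] := pselect (D H); first by exists (a, c).
  by exists (0, 0).
move=> /choice[f fH].
pose sgn x :=
  [tuple dot (f (tnth (in_tuple s) i)).1 x < (f (tnth (in_tuple s) i)).2 | i < size s].
pose cell (u : (size s).-tuple bool) := [set x | complement D x /\ sgn x = u].
apply: (@sub_finite_set _ _ (cell @` setT)); last first.
  by apply: finite_image; exact: finite_finset.
move=> _ [x Dx <-]; exists (sgn x) => //; apply/seteqP; split=> [y [Dy yx]|y xy].
  apply: joined_connected => t t01 [H DH].
  rewrite (fH _ DH) /hyperplane/= !dotE => tH.
  have : H \in s by move: DH; rewrite DE.
  move=> /seq_tnthP[i Hi].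
  have := congr1 (fun u => tnth u i) yx; rewrite !tnth_mktuple -Hi => yxi.
  (* Off [H] the bit [<] determines the strict side, so equal bits rule out a crossing. *)
  have nx : dot (f H).1 x != (f H).2.
    by apply/eqP => h; apply: Dx; exists H => //; rewrite (fH _ DH).
  have ny : dot (f H).1 y != (f H).2.
    by apply/eqP => h; apply: Dy; exists H => //; rewrite (fH _ DH).
  have : (dot (f H).1 x - (f H).2) * (dot (f H).1 y - (f H).2) <= 0.
    by apply/segment_root; exists t; split=> //; rewrite -{}tH; ring.
  apply/negP; rewrite -ltNge.
  move: nx ny yxi; rewrite !neq_lt => /orP[hx|hx] /orP[hy|hy] yxi.
  - by rewrite nmulr_rgt0 ?subr_lt0.
  - by move: hx; rewrite -yxi => /(lt_trans hy); rewrite ltxx.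
  - by move: hy; rewrite yxi => /(lt_trans hx); rewrite ltxx.
  - by rewrite mulr_gt0 ?subr_gt0.
split; first exact: connected_component_sub xy.
apply: eq_from_tnth => i; rewrite !tnth_mktuple; set H := tnth _ i.
have DH : D H by rewrite DE/= mem_tnth.
have DH' : D (hyperplane dot (f H).1 (f H).2) by rewrite -(fH _ DH).
by rewrite (joined_same_side DH' (connected_joined DA xy)).
Qed.

End Chambers.

(** * Action on chambers and counting *)

Lemma ncard_image (T U : choiceType) (f : T -> U) (S : set T) :
  finite_set S -> {in S &, injective f} -> ncard (f @` S) = ncard S.
Proof.
move=> Sfin finj; apply/eqP; rewrite /ncard; apply/eqP.
apply/(fcard_eq (finite_image f Sfin) Sfin).
exact: inj_card_eq.
Qed.

Lemma ncard_setT (T : finType) : ncard [set: T] = #|T|.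
Proof.
rewrite /ncard cardE; apply: perm_size; apply: uniq_perm => [||x].
- exact: fset_uniq.
- exact: enum_uniq.
- rewrite (in_fset_set finite_finset) mem_enum [RHS]inE; apply: mem_set; exact: I.
Qed.

Lemma ncardX (T U : choiceType) (S : set T) (S' : set U) :
  finite_set S -> finite_set S' -> ncard (S `*` S') = (ncard S * ncard S')%N.
Proof.
move=> fS fS'; rewrite /ncard /= -(size_allpairs pair).
apply: perm_size; apply: uniq_perm => [||[x y]].
- exact: fset_uniq.
- by apply: allpairs_uniq; rewrite ?fset_uniq// => -[? ?] [? ?].
rewrite (in_fset_set (finite_setX fS fS')).
apply/idP/allpairsP => [|[[x' y'] /= [+ + [-> ->]]]].
  by rewrite inE => -[/= Sx S'y]; exists (x, y); rewrite !in_fset_set// !inE.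
by rewrite !in_fset_set// !inE.
Qed.

Section Equivariance.
Variables (R : realType) (V : normedModType R) (dot : {dot V for idfun}).
Hypothesis normE : forall x : V, `|x| ^+ 2 = dot x x.
Variables (W : finGroupType) (act : W -> V -> V).
Hypothesis rg : reflection_group dot act.
Implicit Types (g h s w : W) (x y : V) (D : set (set V)).

Local Notation chamber D x := (connected_component (complement D) x).
Local Notation A := (coxeter_arrangement dot act).

Lemma Ch_chamber D b x : Ch D b -> b x -> b = chamber D x.
Proof. by move=> [y Dy <-]; exact: same_connected_component. Qed.

Lemma chamber_Ch D x : complement D x -> Ch D (chamber D x).
Proof. by exists x. Qed.

Lemma chamber_refl D x : complement D x -> chamber D x x.
Proof. exact: connected_component_refl. Qed.

(** Reduces the maps between sets of chambers to a common representative point. *)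
Lemma chamber_of_chamber D C x : D `<=` C -> complement C x ->
  chamber_of D (chamber C x) = chamber D x.
Proof.
move=> DC Cx; have [Dc sub _] := chamber_of_unique DC (chamber_Ch Cx).
exact: Ch_chamber Dc (sub _ (chamber_refl Cx)).
Qed.

Lemma complement_act D g x : stable act D -> complement D x -> complement D (act g x).
Proof.
move=> Dst Dx [H DH Hgx]; apply: Dx; exists (act g^-1%g @` H); first exact: Dst.
by exists (act g x) => //; rewrite (rg_actK rg).
Qed.

Lemma joined_act D g x y : stable act D -> joined D x y ->
  joined D (act g x) (act g y).
Proof.
move=> Dst xy t /xy /(@complement_act _ g _ Dst).
by rewrite (rg_actD rg) (rg_actZ rg) (rg_actB rg).
Qed.

Lemma act_chamber D g x : arrangement dot D -> stable act D ->
  act g @` chamber D x = chamber D (act g x).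
Proof.
move=> DA Dst; apply/seteqP; split=> [_ [y xy <-]|y xy].
  exact/joined_connected/joined_act/(connected_joined normE).
exists (act g^-1%g y); rewrite ?(rg_actVK rg)//.
rewrite -(rg_actK rg g x).
exact/joined_connected/joined_act/(connected_joined normE).
Qed.

Lemma joined_prefix D x y (t : R) : joined D x y -> 0 <= t <= 1 ->
  joined D x (x + t *: (y - x)).
Proof.
move=> xy /andP[t0 t1] u /andP[u0 u1]; rewrite addrAC subrr add0r scalerA.
by apply: xy; rewrite mulr_ge0// mulr_ile1.
Qed.

Lemma coxeter_free g x : complement A x -> chamber A (act g x) = chamber A x -> g = 1%g.
Proof.
move=> Ax gx; have Agx : complement A (act g x).
  by apply: complement_act Ax; exact: coxeter_stable.
have xgx : joined A x (act g x).
  apply: (connected_joined normE (coxeter_arrangementP dot act)).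
  by rewrite -gx; exact: chamber_refl.
(* Pass to the inverse: [dot (act g^-1 a) x = dot a (act g x)], which is positive because no mirror
   separates [x] from [act g x]. *)
apply/invg_inj; rewrite invg1.
apply: (positive_preserving_eq1 rg Ax) => h hr.
have [a1 ax ha] := positive_rootP Ax hr; set a := positive_root _ _ _ _ in a1 ax ha *.
rewrite (rg_dotl rg) invgK.
have a0 : a != 0.
  by apply/eqP => a0; move: a1; rewrite a0 dot0l => /eqP; rewrite eq_sym oner_eq0.
have AH : A (hyperplane dot a 0) by exists h, a.
rewrite lt_neqAle leNgt -(joined_same_side AH xgx) -leNgt (ltW ax) andbT eq_sym.
exact: (regular_dot_neq0 Agx a0 ha).
Qed.

(* The reflection in a hyperplane meeting a chamber [b] of [D] preserves [b],
   because it fixes a point of [b]. *)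
Lemma chamber_transitive D x y : arrangement dot D -> stable act D ->
  complement A x -> complement A y -> chamber D x y ->
  exists g, chamber D x = chamber D (act g x) /\
            chamber (A `|` D) (act g x) = chamber (A `|` D) y.
Proof.
move=> DA Dst Ax Ay xy.
pose Q g := `[< chamber D x (act g x) >].
have Q1 : Q 1%g.
  apply/asboolP; rewrite (rg_act1E rg); apply: connected_component_refl.
  exact: connected_component_sub (connected_component_sym xy).
case: (arg_minP (fun g => dot (act g x - y) (act g x - y)) Q1) => g /asboolP gx gmin.
exists g; split; first exact: same_connected_component.
have gxy : chamber D (act g x) y.
  exact: connected_component_trans (connected_component_sym gx) xy.
have jD := connected_joined normE DA gxy.
apply/same_connected_component/joined_connected/joinedU => // t t01.
case=> _ [s [a [a0 sa ->]]]; rewrite /hyperplane/= => tH.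
have Agx : complement A (act g x) by apply: complement_act Ax; exact: coxeter_stable.
have /gmin : Q (s * g)%g.
  apply/asboolP; apply: connected_component_trans gx _.
  (* The crossing point lies in the chamber of [act g x] and is fixed by [s], so [s] maps that
     chamber to itself. *)
  have p1 : chamber D (act g x) (act g x + t *: (y - act g x)).
    by apply: joined_connected; exact: joined_prefix.
  apply: (connected_component_trans p1); apply: connected_component_sym.
  have : chamber D (act s (act g x)) (act s (act g x + t *: (y - act g x))).
    by rewrite -act_chamber//; exists (act g x + t *: (y - act g x)).
  rewrite (rg_actME rg) [X in _ X -> _](_ : _ = act g x + t *: (y - act g x)) //.
  by rewrite sa reflection_id.
(* The mirror of [s] strictly separates [act g x] from [y], so [s * g] would beat the minimum. *)
rewrite leNgt (rg_actME rg) sa => /negP; apply; apply: reflection_closer.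
rewrite lt_neqAle; apply/andP; split.
  by rewrite mulf_neq0 ?(regular_dot_neq0 Agx a0 sa) ?(regular_dot_neq0 Ay a0 sa).
by apply/segment_root; exists t; split=> //; rewrite -tH !dotE.
Qed.

Lemma coxeter_transitive x y : complement A x -> complement A y ->
  exists g, chamber A (act g x) = chamber A y.
Proof.
move=> Ax Ay; have e0 : arrangement dot set0 by split; [exact: finite_set0|].
have : chamber set0 x y by apply: joined_connected => t _ [].
move=> /(chamber_transitive e0)[] // g [_].
by rewrite setU0 => gxy; exists g.
Qed.

Lemma act_imageM g h (b : set V) : act g @` (act h @` b) = act (g * h)%g @` b.
Proof. by rewrite image_comp (rg_actM rg). Qed.

Lemma orbit_of_act g (b : set V) : orbit_of act (act g @` b) = orbit_of act b.
Proof.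
apply/seteqP; split=> _ [h _ <-]; first by exists (h * g)%g; rewrite // act_imageM.
by exists (h * g^-1)%g; rewrite // act_imageM mulgKV.
Qed.

(** * Bijections between fibers, orbits and group elements *)

Section Counting.
Variable B : set (set V).
Hypotheses (BA : arrangement dot B) (Bst : stable act B).
Local Notation C := (A `|` B).

Let AC : A `<=` C. Proof. exact: subsetUl. Qed.
Let BC : B `<=` C. Proof. exact: subsetUr. Qed.
Let AA : arrangement dot A := coxeter_arrangementP dot act.
Let Ast : stable act A := coxeter_stable rg.

Lemma union_arrangement : arrangement dot C.
Proof.
have [Afin Ahyp] := AA; have [Bfin Bhyp] := BA.
by split; [rewrite finite_setU|move=> H [/Ahyp|/Bhyp]].
Qed.

Lemma union_stable : stable act C.
Proof. by move=> g H [/Ast|/Bst]; [left|right]. Qed.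

Let CA := union_arrangement.
Let Cst := union_stable.

Let CcA x : complement C x -> complement A x.
Proof. by rewrite complementU => -[]. Qed.

Let CcB x : complement C x -> complement B x.
Proof. by rewrite complementU => -[]. Qed.

Lemma union_free g x : complement C x -> chamber C (act g x) = chamber C x -> g = 1%g.
Proof.
move=> Cx gx; apply: (coxeter_free (CcA Cx)).
have Cgx : complement C (act g x) by exact: complement_act.
by rewrite -(chamber_of_chamber AC Cgx) gx (chamber_of_chamber AC Cx).
Qed.

(** Simple transitivity: [g] corresponds to the chamber of [act g x]. *)
Lemma ncard_Ch_coxeter x : complement A x -> ncard (Ch A) = #|W|.
Proof.
move=> Ax; rewrite -ncard_setT.
rewrite -(@ncard_image _ _ (fun g => chamber A (act g x)) [set: W]).
- congr ncard; apply/seteqP; split=> [_ [y Ay <-]|_ [g _ <-]].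
    by have [g gxy] := coxeter_transitive Ax Ay; exists g.
  by apply: chamber_Ch; exact: complement_act.
- exact: finite_finset.
move=> g h _ _ /= gh; apply/eqP; rewrite eq_mulVg1; apply/eqP.
apply: (coxeter_free Ax); rewrite (rg_actME rg) -act_chamber// -gh.
by rewrite act_chamber// (rg_actK rg).
Qed.

Lemma fiber_chamber D c x : D `<=` C -> fiber C D (chamber D x) c ->
  exists2 y, complement C y & c = chamber C y /\ chamber D y = chamber D x.
Proof. by move=> DC [[y Cy <-]]; rewrite chamber_of_chamber// => yx; exists y. Qed.

Lemma chamber_fiber D x y : D `<=` C -> complement C y ->
  chamber D y = chamber D x -> fiber C D (chamber D x) (chamber C y).
Proof.
by move=> DC Cy yx; split; [exact: chamber_Ch|rewrite chamber_of_chamber].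
Qed.

Lemma fiber_finite D d : finite_set (fiber C D d).
Proof. by apply: sub_finite_set (Ch_finite normE CA) => c []. Qed.

(** The pair [(c, g)] corresponds to the translate of [c] by [g]: transitivity on [Ch A] gives
    surjectivity, freeness injectivity. *)
Lemma ncard_Ch_union x : complement A x ->
  ncard (Ch C) = (ncard (fiber C A (chamber A x)) * #|W|)%N.
Proof.
move=> Ax; rewrite -ncard_setT -ncardX; [|exact: fiber_finite|exact: finite_finset].
rewrite -(@ncard_image _ _ (fun p => act p.2 @` p.1) (fiber C A (chamber A x) `*` [set: W])).
- congr ncard; apply/seteqP; split=> [_ [y Cy <-]|_ [[c g] [/= fc _] <-]].
    have [g gyx] := coxeter_transitive (CcA Cy) Ax.
    exists (chamber C (act g y), g^-1%g); last first.
      by rewrite /= act_chamber// (rg_actK rg).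
    by split=> //=; apply: chamber_fiber => //; exact: complement_act.
  have [y Cy [-> _]] := fiber_chamber AC fc.
  by rewrite act_chamber//; apply: chamber_Ch; exact: complement_act.
- by apply: finite_setX; [exact: fiber_finite|exact: finite_finset].
move=> [c g] [d h]; rewrite !inE /= => -[/= fc _] [/= fd _].
have [y Cy [-> yx]] := fiber_chamber AC fc.
have [z Cz [-> zx]] := fiber_chamber AC fd.
rewrite !act_chamber// => gh.
have gh' : chamber C (act (h^-1 * g)%g y) = chamber C z.
  by rewrite (rg_actME rg) -act_chamber// gh act_chamber// (rg_actK rg).
have Chy : complement C (act (h^-1 * g)%g y) by exact: complement_act.
have hg : (h^-1 * g)%g = 1%g.
  apply: (coxeter_free (CcA Cy)).
  by rewrite -(chamber_of_chamber AC Chy) gh' chamber_of_chamber// zx yx.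
move: gh'; rewrite hg (rg_act1E rg) => ->; congr pair.
by apply/eqP; rewrite eq_sym eq_mulVg1 hg.
Qed.

(** The fiber over one chamber of [A] is a transversal of the orbits: every orbit meets it by
    transitivity, and only once by freeness. *)
Lemma ncard_orbits_union x : complement A x ->
  ncard (orbits act C) = ncard (fiber C A (chamber A x)).
Proof.
move=> Ax; rewrite -(@ncard_image _ _ (orbit_of act) (fiber C A (chamber A x))).
- congr ncard; apply/seteqP; split=> [_ [_ [y Cy <-] <-]|_ [c [Cc _] <-]]; last first.
    by exists c.
  have [g gyx] := coxeter_transitive (CcA Cy) Ax.
  exists (chamber C (act g y)); last by rewrite -act_chamber// orbit_of_act.
  by apply: chamber_fiber => //; exact: complement_act.
- exact: fiber_finite.
move=> c d; rewrite !inE => fc fd.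
have [y Cy [-> yx]] := fiber_chamber AC fc.
have [z Cz [-> zx]] := fiber_chamber AC fd.
move=> yz; have : orbit_of act (chamber C z) (chamber C y).
  by rewrite -yz; exists 1%g; rewrite // (rg_act1 rg) image_id.
move=> [g _]; rewrite act_chamber// => gzy.
have Cgz : complement C (act g z) by exact: complement_act.
have g1 : g = 1%g.
  apply: (coxeter_free (CcA Cz)).
  by rewrite -(chamber_of_chamber AC Cgz) gzy chamber_of_chamber// zx yx.
by move: gzy; rewrite g1 (rg_act1E rg).
Qed.

Lemma chamber_of_orbit x : complement C x ->
  chamber_of B @` orbit_of act (chamber C x) = orbit_of act (chamber B x).
Proof.
have sub g y : complement C y ->
    chamber_of B (act g @` chamber C y) = act g @` chamber B y.
  move=> Cy; rewrite !act_chamber// chamber_of_chamber//.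
  exact: complement_act.
move=> Cx; apply/seteqP; split=> [_ [_ [g _ <-] <-]|_ [g _ <-]].
  by rewrite sub//; exists g.
by exists (act g @` chamber C x); [exists g|rewrite sub].
Qed.

(** Surjectivity of the map to [Ch B]: an open chamber is not covered by the mirrors. *)
Lemma chamber_meets_union x : complement B x ->
  exists2 y, complement C y & chamber B y = chamber B x.
Proof.
move=> Bx; have [y xy Ay] := avoid_hyperplanes normE AA (chamber_open normE x BA)
  (chamber_refl Bx).
exists y; first by rewrite complementU; split=> //; exact: connected_component_sub xy.
exact/esym/same_connected_component.
Qed.

(** [chamber_of B] induces a bijection on orbits. It is injective because chambers of [C] inside one
    chamber of [B] are conjugate. *)
Lemma ncard_orbits_eq : ncard (orbits act C) = ncard (orbits act B).
Proof.
rewrite -(@ncard_image _ _ (fun o => chamber_of B @` o) (orbits act C)).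
- congr ncard; apply/seteqP; split=> [_ [_ [_ [x Cx <-] <-] <-]|_ [_ [x Bx <-] <-]].
    rewrite chamber_of_orbit//; exists (chamber B x) => //.
    exact/chamber_Ch/CcB.
  have [y Cy <-] := chamber_meets_union Bx.
  exists (orbit_of act (chamber C y)); last exact: chamber_of_orbit.
  by exists (chamber C y) => //; exact: chamber_Ch.
- by apply: finite_image; exact: (Ch_finite normE CA).
move=> o o'; rewrite !inE => -[_ [x Cx <-] <-] [_ [y Cy <-] <-] /=.
rewrite !chamber_of_orbit// => xy.
have : orbit_of act (chamber B y) (chamber B x).
  by rewrite -xy; exists 1%g; rewrite // (rg_act1 rg) image_id.
move=> [g _]; rewrite act_chamber// => gyx.
have Cgy : complement C (act g y) by exact: complement_act.
(* After translation by [g] both points lie in one chamber of [B], where [chamber_transitive]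
   applies. *)
have bgyx : chamber B (act g y) x by rewrite gyx; exact/chamber_refl/CcB.
have [h [_ hgy]] := chamber_transitive BA Bst (CcA Cgy) (CcA Cx) bgyx.
by rewrite -hgy -act_chamber// orbit_of_act -act_chamber// orbit_of_act.
Qed.

(** The stabilizer acts simply transitively on the fiber, so its orbit map at the chamber of [y] is
    a bijection. *)
Lemma ncard_fiber_stabilizer b : Ch B b ->
  ncard (fiber C B b) = ncard (stabilizer act b).
Proof.
move=> [x Bx <-]; have [y Cy <-] := chamber_meets_union Bx.
rewrite -(@ncard_image _ _ (fun g => chamber C (act g y)) (stabilizer act (chamber B y))).
- congr ncard; apply/seteqP; split=> [c fc|_ [g gb <-]].
    have [z Cz [-> zy]] := fiber_chamber BC fc.
    have yz : chamber B y z by rewrite -zy; exact/chamber_refl/CcB.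
    have [g [gy gz]] := chamber_transitive BA Bst (CcA Cy) (CcA Cz) yz.
    by exists g => //; rewrite /stabilizer/= act_chamber.
  apply: chamber_fiber => //; first exact: complement_act.
  by move: gb; rewrite /stabilizer/= act_chamber.
- exact: finite_finset.
move=> g h _ _ /= gh; apply/eqP; rewrite eq_sym eq_mulVg1; apply/eqP.
apply: (union_free Cy); rewrite (rg_actME rg) -act_chamber// gh.
by rewrite act_chamber// (rg_actK rg).
Qed.

End Counting.
End Equivariance.

Unset Implicit Arguments.

Theorem theorem6 (R : realType) (V : normedModType R)
    (dot : {dot V for idfun}) (W : finGroupType) (act : W -> V -> V)
    (B : set (set V)) :
  euclidean dot ->
  reflection_group dot act ->
  arrangement dot B ->
  stable act B ->
  coxeter_arrangement dot act `&` B = set0 ->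
  let A := coxeter_arrangement dot act in
  let C := A `|` B in
  [/\ finite_set (Ch A), finite_set (Ch B) & finite_set (Ch C)] /\
  (forall a : set V, Ch A a ->
    [/\ (ncard (fiber C A a))%:R = (ncard (Ch C))%:R / (ncard (Ch A))%:R :> rat,
        (ncard (Ch C))%:R / (ncard (Ch A))%:R
          = (ncard (Ch C))%:R / #|W|%:R :> rat,
        (ncard (Ch C))%:R / #|W|%:R = (ncard (orbits act C))%:R :> rat &
        ncard (orbits act C) = ncard (orbits act B)]) /\
  (forall b : set V, Ch B b ->
    ncard (fiber C B b) = ncard (stabilizer act b)).
Proof.
move=> [_ normE] rg BA Bst _ A C.
split; first split.
- exact: (Ch_finite normE (coxeter_arrangementP dot act)).
- exact: (Ch_finite normE BA).
- exact: (Ch_finite normE (union_arrangement act BA)).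
split=> [_ [x Ax <-]|b Bb]; last exact: (ncard_fiber_stabilizer normE rg BA Bst Bb).
have W0 : #|W|%:R != 0 :> rat by rewrite pnatr_eq0 -lt0n -cardsT cardG_gt0.
have AW := ncard_Ch_coxeter normE rg Ax.
have CW := ncard_Ch_union normE rg BA Bst Ax.
have fE : (ncard (Ch C))%:R / #|W|%:R
    = (ncard (fiber C A (connected_component (complement A) x)))%:R :> rat.
  by rewrite CW natrM mulfK.
(* With [Ch A] counted by [W], every quotient is the size of the fiber over the chamber of [x]. *)
split; rewrite ?AW ?fE//; last exact: (ncard_orbits_eq normE rg BA Bst).
by rewrite (ncard_orbits_union normE rg BA Bst Ax).
Qed.
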